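(* Let $n\ge2$, let $p_0\ne p_1$ be points of $\mathbb{R}^n$, let $u=\frac{p_1-p_0}{\|p_1-p_0\|}$, and let $v_0=v_1=u$ (so that $(p_0,v_0)$ and $(p_1,v_1)$ are two geometric Hermite samples, point and unit tangent, of the straight line through $p_0,p_1$ with direction $u$). Then for every $\omega\in[0,1]$, $$B_\omega\left((p_0,v_0),(p_1,v_1)\right)=\left((1-\omega)p_0+\omega p_1,\ u\right).$$
   Context: $\mathbb{R}^n$ carries the Euclidean inner product $\langle\cdot,\cdot\rangle$ and norm $\|\cdot\|$; $S^{n-1}$ is the unit sphere. For $(p_0,v_0),(p_1,v_1)\in\mathbb{R}^n\times S^{n-1}$ with $p_0\ne p_1$ put $u=\frac{p_1-p_0}{\|p_1-p_0\|}$ and $\theta_j=\arccos\langle v_j,u\rangle\in[0,\pi]$, $j=0,1$. Bézier average (for $p_0\ne p_1$ and $\theta_0+\theta_1<2\pi$): put $\alpha=\dfrac{\|p_1-p_0\|}{3\cos^2\left(\frac{\theta_0+\theta_1}{4}\right)}$, and let $b(t)$, $t\in[0,1]$, be the cubic Bézier curve with control points $p_0,\ p_0+\alpha v_0,\ p_1-\alpha v_1,\ p_1$, i.e. $$b(t)=(1-t)^3p_0+3t(1-t)^2(p_0+\alpha v_0)+3t^2(1-t)(p_1-\alpha v_1)+t^3p_1.$$ For $\omega\in[0,1]$, $B_\omega\left((p_0,v_0),(p_1,v_1)\right)=(p_\omega,v_\omega)$ with $p_\omega=b(\omega)$ and $v_\omega=\frac{b'(\omega)}{\|b'(\omega)\|}$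 if $b'(\omega)\ne0$, $v_\omega=0$ if $b'(\omega)=0$. *)

(* Defs.v *)
From mathcomp Require Import all_boot all_order all_algebra.
From mathcomp Require Import all_classical all_reals all_analysis.

Set Implicit Arguments.
Unset Strict Implicit.
Unset Printing Implicit Defensive.

Import Order.TTheory GRing.Theory Num.Theory.
Import numFieldNormedType.Exports.

Local Open Scope ring_scope.

(* The library norm on 'rV[R]_n is the sup norm, so the Euclidean inner product
   and norm are defined here. The derivative below uses the library topology,
   which is the same for both norms. *)
Definition dot (R : realType) (n : nat) (x y : 'rV[R]_n) : R :=
  \sum_(i < n) x 0 i * y 0 i.

Definition enorm (R : realType) (n : nat) (x : 'rV[R]_n) : R :=
  Num.sqrt (dot x x).

Definition unit_dir (R : realType) (n : nat) (p0 p1 : 'rV[R]_n) : 'rV[R]_n :=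
  (enorm (p1 - p0))^-1 *: (p1 - p0).

Definition angle (R : realType) (n : nat) (p0 p1 v : 'rV[R]_n) : R :=
  acos (dot v (unit_dir p0 p1)).

Definition bezier_alpha (R : realType) (n : nat) (p0 v0 p1 v1 : 'rV[R]_n) : R :=
  enorm (p1 - p0) /
  (3 * cos ((angle p0 p1 v0 + angle p0 p1 v1) / 4) ^+ 2).

(* Defined on all of R; at the endpoints of [0, 1] the two-sided derivative
   coincides with the one-sided derivative of the restriction to [0, 1]. *)
Definition bezier_curve (R : realType) (n : nat) (p0 v0 p1 v1 : 'rV[R]_n)
    (t : R) : 'rV[R]_n :=
  let a := bezier_alpha p0 v0 p1 v1 in
  (1 - t) ^+ 3 *: p0
  + (3 * t * (1 - t) ^+ 2) *: (p0 + a *: v0)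
  + (3 * t ^+ 2 * (1 - t)) *: (p1 - a *: v1)
  + t ^+ 3 *: p1.

(* A sample is a pair (point, vector). The function is total, but it is only
   meaningful for unit vectors q0.2 and q1.2, q0.1 != q1.1, angles with sum
   < 2 * pi, and w in [0, 1]. The second component of the result is a unit
   vector or 0. *)
Definition bezier_average (R : realType) (n : nat) (w : R)
    (q0 q1 : 'rV[R]_n * 'rV[R]_n) : 'rV[R]_n * 'rV[R]_n :=
  let b := bezier_curve q0.1 q0.2 q1.1 q1.2 in
  let d := derive1 b w in
  (b w, if d == 0 then 0 else (enorm d)^-1 *: d).

(* Main.v *)
Require Import Defs.
From mathcomp Require Import all_boot all_order all_algebra.
From mathcomp Require Import all_classical all_reals all_analysis.
From mathcomp Require Import ring.

(** Both tangents equal the chord direction [u], so both angles are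
    [acos <u, u> = acos 1 = 0] and the handle length [alpha] is a third of the
    chord length (lemma [bezier_alpha_unit_dir]).  The inner control points
    [p0 + alpha u] and [p1 - alpha u] therefore divide the chord into three
    equal parts.  Equally spaced control points are the degree elevation of the
    linear Bezier curve, so the cubic is the uniform parametrization
    [t |-> (1 - t) p0 + t p1] of the line (lemma [bezier_curve_unit_dir]).  Its
    derivative is the constant nonzero vector [p1 - p0], whose normalization
    is [u] by definition. *)

Import Order.TTheory GRing.Theory Num.Theory.
Import numFieldNormedType.Exports.

Local Open Scope ring_scope.

Lemma dot_gt0 (R : realType) (n : nat) (x : 'rV[R]_n) : x != 0 -> 0 < dot x x.
Proof.
move=> x0; rewrite lt_neqAle sumr_ge0 ?andbT; last first.
  by move=> i _; rewrite -expr2 sqr_ge0.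
apply: contra x0; rewrite eq_sym psumr_eq0; last first.
  by move=> i _; rewrite -expr2 sqr_ge0.
move=> /allP x0; apply/eqP/rowP => i; rewrite mxE; apply/eqP.
by have := x0 i (mem_index_enum _); rewrite /= mulf_eq0 orbb.
Qed.

Lemma enorm_gt0 (R : realType) (n : nat) (x : 'rV[R]_n) :
  x != 0 -> 0 < enorm x.
Proof. by move=> x0; rewrite sqrtr_gt0 dot_gt0. Qed.

Lemma enorm_unit_dir (R : realType) (n : nat) (p0 p1 : 'rV[R]_n) :
  p0 != p1 -> enorm (p1 - p0) *: unit_dir p0 p1 = p1 - p0.
Proof.
move=> p01; rewrite scalerA mulfV ?scale1r // gt_eqF // enorm_gt0 //.
by rewrite subr_eq0 eq_sym.
Qed.

Lemma dotZ (R : realType) (n : nat) (a : R) (x : 'rV[R]_n) :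
  dot (a *: x) (a *: x) = a ^+ 2 * dot x x.
Proof.
by rewrite /dot mulr_sumr; apply: eq_bigr => i _; rewrite !mxE; ring.
Qed.

Lemma dot_unit_dir (R : realType) (n : nat) (p0 p1 : 'rV[R]_n) :
  p0 != p1 -> dot (unit_dir p0 p1) (unit_dir p0 p1) = 1.
Proof.
move=> p01; have d0 : 0 < dot (p1 - p0) (p1 - p0).
  by rewrite dot_gt0 // subr_eq0 eq_sym.
by rewrite dotZ exprVn sqr_sqrtr ?mulVf ?gt_eqF // ltW.
Qed.

Lemma angle_unit_dir (R : realType) (n : nat) (p0 p1 : 'rV[R]_n) :
  p0 != p1 -> angle p0 p1 (unit_dir p0 p1) = 0.
Proof. by move=> p01; rewrite /angle dot_unit_dir // acos1. Qed.

Lemma bezier_alpha_unit_dir (R : realType) (n : nat) (p0 p1 : 'rV[R]_n) :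
  p0 != p1 ->
  bezier_alpha p0 (unit_dir p0 p1) p1 (unit_dir p0 p1) = enorm (p1 - p0) / 3.
Proof.
move=> p01.
by rewrite /bezier_alpha angle_unit_dir // addr0 mul0r cos0 expr1n mulr1.
Qed.

Lemma bezier_curve_unit_dir (R : realType) (n : nat) (p0 p1 : 'rV[R]_n)
    (t : R) : p0 != p1 ->
  bezier_curve p0 (unit_dir p0 p1) p1 (unit_dir p0 p1) t
  = (1 - t) *: p0 + t *: p1.
Proof.
move=> p01; rewrite /bezier_curve bezier_alpha_unit_dir //.
have -> : (enorm (p1 - p0) / 3) *: unit_dir p0 p1 = 3^-1 *: (p1 - p0).
  by rewrite mulrC -scalerA enorm_unit_dir.
by apply/rowP => i; rewrite !mxE; field.
Qed.

(** The difference quotient of a uniform parametrization of a line is constant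
    away from increment [0], so its limit is that constant. *)
Lemma derive1_line (R : realType) (V : normedModType R) (p0 p1 : V) (w : R) :
  derive1 (fun t : R => (1 - t) *: p0 + t *: p1) w = p1 - p0.
Proof.
rewrite /derive1; apply: cvg_lim => //.
apply: cvg_near_cst; near=> h.
have h0 : h != 0 by near: h; exact: nbhs_dnbhs_neq.
(* Regroup as [p0 + t *: (p1 - p0)]: the base point cancels in the quotient. *)
have lineE t : (1 - t) *: p0 + t *: p1 = p0 + t *: (p1 - p0).
  by rewrite scalerBl scale1r scalerBr addrAC addrA.
rewrite !lineE opprD addrACA subrr add0r -scalerBl addrK.
by rewrite scalerA mulVf // scale1r.
Unshelve. all: by end_near. Qed.

Theorem lemma2p10 (R : realType) (n : nat) (hn : (2 <= n)%N)
    (p0 p1 v0 v1 : 'rV[R]_n) (hp : p0 != p1)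
    (hv0 : v0 = unit_dir p0 p1) (hv1 : v1 = unit_dir p0 p1)
    (w : R) (hw : 0 <= w <= 1) :
  bezier_average w (p0, v0) (p1, v1)
  = ((1 - w) *: p0 + w *: p1, unit_dir p0 p1).
Proof.
rewrite hv0 hv1 /bezier_average /=.
have -> : bezier_curve p0 (unit_dir p0 p1) p1 (unit_dir p0 p1)
          = fun t => (1 - t) *: p0 + t *: p1.
  by apply/funext => t; exact: bezier_curve_unit_dir.
by rewrite derive1_line subr_eq0 eq_sym (negPf hp).
Qed.
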